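(* Let $G$ be a directed graph in which every vertex has finitely many out-neighbours, let $\Gamma=\mathcal{C}(G)$ be its clausal theory, and let $A\subseteq \ddot G$ be a clause. Then $\Gamma\models A$ if and only if at least one of the following holds: (1) $A\subseteq \ddot{G^\bot}$ and $G^\bot\neq\emptyset$; (2) there is a nonempty clause $B\subseteq A\cap \ddot{G^{ok}}$ such that $\Gamma\vdash B$.
   Context: A graph is a directed graph $G=\langle G,A_G\rangle$, $A_G\subseteq G\times G$ (loops allowed). Put $A_G(x)=\{y\mid (x,y)\in A_G\}$, $A^-_G(x)=\{y\mid x\in A_G(y)\}$; for $X\subseteq G$, $A_G(X)=\bigcup_{x\in X}A_G(x)$, $A^-_G(X)=\bigcup_{x\in X}A^-_G(x)$, $A_G[X]=X\cup A_G(X)$, $A^-_G[X]=X\cup A^-_G(X)$. Vertices are propositional atoms. For $X\subseteq G$, $\ddot X=X\cup\{\overline x\mid x\in X\}$ is the set of literals over $X$ ($\overline x$ is the negation of $x$). A clause is a finite set of literals; $\{\}$ is the empty clause. The clausal theory $\mathcal{C}(G)$ contains, for each $x\in G$, the clause $\{x\}\cup A_G(x)$ and, for each $y\in A_G(x)$, the clause $\{\overline x,\overline y\}$. $\Gamma\vdash C$ means that $C$ is derivable from the clauses of $\Gamma$ in the system RES, consisting of the axioms $\{a,\overline a\}$ for every atom $a\in G$ and the resolution rule: from $A\cup\{a\}$ and $B\cup\{\overline a\}$ infer $A\cup B$. $G^\bot=\{x\in G\mid \Gamma\vdash \{x\}\text{ and }\Gamma\vdash\{\overline x\}\}$ and $G^{ok}=G\setminus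 G^\bot$. A semikernel of $G$ is a set $S\subseteq G$ with $A_G(S)\subseteq A^-_G(S)\subseteq G\setminus S$; $SK(G)$ is the set of semikernels. $\mathrm{Mod}(G)$ is the set of all $S\in SK(G)$ such that $A^-_G(A^-_G[S])\subseteq A^-_G[S]$ and there is no $R\in SK(G)$ with $A^-_G(A^-_G[R])\subseteq A^-_G[R]$ and $A^-_G[S]\subsetneq A^-_G[R]$. A 3-partition of $G$ is a triple $\alpha=\langle\alpha^{\mathbf 1},\alpha^{\mathbf 0},\alpha^\bot\rangle$ of pairwise disjoint (possibly empty) sets with union $G$. For a clause $C$ with set of positively occurring atoms $P$ and set of negatively occurring atoms $N$, $\alpha\models C$ iff $P\cap\alpha^{\mathbf 1}\neq\emptyset$, or $N\cap\alpha^{\mathbf 0}\neq\emptyset$, or ($P\cup N\subseteq\alpha^\bot$ and $\alpha^\bot\neq\emptyset$). For $S\in\mathrm{Mod}(G)$ let $\alpha_S=\langle S,\,A^-_G(S),\,G\setminus A^-_G[S]\rangle$. $\Gamma\models C$ means that $\alpha_S\models C$ for every $S\in\mathrm{Mod}(G)$. *)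

(* Defs.v *)
From mathcomp Require Import all_boot.
From mathcomp Require Import boolp classical_sets functions cardinality.

Set Implicit Arguments.
Unset Strict Implicit.
Unset Printing Implicit Defensive.

Local Open Scope classical_set_scope.

(* A digraph is a vertex type [G], possibly infinite or empty, with an
   arbitrary arc relation [E]. *)
Section Digraph.
Variables (G : Type) (E : G -> G -> Prop).

Definition out (x : G) : set G := [set y | E x y].
Definition inn (x : G) : set G := [set y | out y x].
Definition outs (X : set G) : set G := \bigcup_(x in X) out x.
Definition inns (X : set G) : set G := \bigcup_(x in X) inn x.
Definition inns_refl (X : set G) : set G := X `|` inns X.

End Digraph.

Inductive literal (G : Type) : Type := Pos of G | Neg of G.

Definition literals (G : Type) (X : set G) : set (literal G) :=
  (@Pos G @` X) `|` (@Neg G @` X).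

(* Clauses are the sets of literals that are finite. *)
Definition is_clause (G : Type) (C : set (literal G)) : Prop := finite_set C.

Definition pos_atoms (G : Type) (C : set (literal G)) : set G :=
  [set x | C (Pos x)].
Definition neg_atoms (G : Type) (C : set (literal G)) : set G :=
  [set x | C (Neg x)].

Definition clausal_theory (G : Type) (E : G -> G -> Prop) :
    set (set (literal G)) :=
  [set C | (exists x, C = [set Pos x] `|` (@Pos G @` out E x))
        \/ (exists x y, out E x y /\ C = [set Neg x; Neg y])].

(* If all the members of [Gamma] are finite then so are all derivable sets of
   literals. In [RES_resolution] the side [A] may itself contain [Pos a], and
   [B] may contain [Neg a]. *)
Inductive RES (G : Type) (Gamma : set (set (literal G))) :
    set (literal G) -> Prop :=
| RES_hyp C : Gamma C -> RES Gamma C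
| RES_axiom (a : G) : RES Gamma [set Pos a; Neg a]
| RES_resolution (A B : set (literal G)) (a : G) :
    RES Gamma (A `|` [set Pos a]) -> RES Gamma (B `|` [set Neg a]) ->
    RES Gamma (A `|` B).

Section Semantics.
Variables (G : Type) (E : G -> G -> Prop).

Definition Gbot : set G :=
  [set x | RES (clausal_theory E) [set Pos x]
        /\ RES (clausal_theory E) [set Neg x]].
Definition Gok : set G := ~` Gbot.

Definition semikernel (S : set G) : Prop :=
  outs E S `<=` inns E S /\ inns E S `<=` ~` S.

Definition inns_closed (S : set G) : Prop :=
  inns E (inns_refl E S) `<=` inns_refl E S.

Definition Mod (S : set G) : Prop :=
  [/\ semikernel S, inns_closed S &
      ~ exists R : set G,
          [/\ semikernel R, inns_closed R &
              inns_refl E S `<` inns_refl E R]].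

End Semantics.

Record set_triple (G : Type) : Type := SetTriple {
  val1 : set G;
  val0 : set G;
  valbot : set G }.

Definition is_3partition (G : Type) (alpha : set_triple G) : Prop :=
  [/\ val1 alpha `&` val0 alpha = set0,
      val1 alpha `&` valbot alpha = set0,
      val0 alpha `&` valbot alpha = set0 &
      val1 alpha `|` val0 alpha `|` valbot alpha = setT].

Definition sat (G : Type) (alpha : set_triple G) (C : set (literal G)) : Prop :=
  [\/ pos_atoms C `&` val1 alpha !=set0,
      neg_atoms C `&` val0 alpha !=set0 |
      pos_atoms C `|` neg_atoms C `<=` valbot alpha /\ valbot alpha !=set0].

Definition alpha_of (G : Type) (E : G -> G -> Prop) (S : set G) : set_triple G :=
  SetTriple S (inns E S) (~` inns_refl E S).

Lemma alpha_of_3partition (G : Type) (E : G -> G -> Prop) (S : set G) :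
  semikernel E S -> is_3partition (alpha_of E S).
Proof.
move=> [_ SN]; split => /=.
- by apply/seteqP; split => // x [Sx /SN].
- by apply/seteqP; split => // x [Sx]; apply; left.
- by apply/seteqP; split => // x [Sx]; apply; right.
- by rewrite -/(inns_refl E S) setUv.
Qed.

Definition entails (G : Type) (E : G -> G -> Prop) (C : set (literal G)) : Prop :=
  forall S : set G, Mod E S -> sat (alpha_of E S) C.

(* Main.v *)
(* Resolution is sound for every triple [alpha_of S] with [S] a semikernel whose
   [inns_refl E S] is closed under predecessors, so such triples leave the atoms
   of [Gbot] undefined.  Conversely, the derivable nonempty clauses over [Gok]
   are closed under resolution: an empty resolvent would come from [{a}] and
   [{~a}], putting [a] in [Gbot].  Hence a maximal set of literals containing no
   such clause is the set of false literals of a valuation of [Gok], whose true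
   atoms form a semikernel defined exactly on [Gok].  Therefore every member of
   [Mod] is defined exactly on [Gok], and a set of literals containing no
   derivable nonempty clause over [Gok] has its [Gok]-part falsified by some
   member of [Mod]. *)
Require Import Defs.
From mathcomp Require Import all_boot.
From mathcomp Require Import boolp classical_sets functions cardinality.
Set Implicit Arguments.
Unset Strict Implicit.
Local Open Scope classical_set_scope.

(** * Maximal sets that include no member of a family of finite sets *)

Lemma finite_set_induction (T : Type) (P : set T -> Prop) :
  P set0 -> (forall x X, P X -> P (x |` X)) ->
  forall X, finite_set X -> P X.
Proof.
elim/Pchoice: T => T in P *.
move=> P0 PU X /finite_seqP[s ->]; elim: s => [|x s IHs]; first by rewrite set_nil.
rewrite (_ : [set` x :: s] = x |` [set` s]); first exact: PU.
by apply/seteqP; split=> y /=; rewrite in_cons; [move/predU1P|move=> ?; exact/predU1P].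
Qed.

(** Each of the finitely many points outside [A] lies in some member of the chain, and the largest
    of these members holds them all. The first alternative keeps the empty chain harmless. *)
Lemma finite_sub_bigcup_chain (T : Type) (F : set (set T)) (A C : set T) :
  total_on F subset -> finite_set C ->
  C `<=` (\bigcup_(X in F) X) `|` A ->
  C `<=` A \/ exists2 X, F X & C `<=` X `|` A.
Proof.
move=> totF; elim/finite_set_induction: C / => [|x C IH] sub; first by left.
have {}IH : C `<=` A \/ exists2 X, F X & C `<=` X `|` A.
  by apply: IH => y Cy; apply: sub; right.
have [[Y FY Yx]|Ax] := sub x (or_introl erefl).
- right; case: IH => [CA|[X FX CX]].
    by exists Y => // y [->|/CA]; [left|right].
  have [XY|YX] := totF _ _ FX FY.
    by exists Y => // y [->|/CX[/XY|]]; [left|left|right].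
  by exists X => // y [->|/CX //]; left; exact: YX.
- case: IH => [CA|[X FX CX]]; first by left => y [->|/CA].
  by right; exists X => // y [->|/CX //]; right.
Qed.

Lemma maximal_avoiding (T : Type) (Delta : set (set T)) (A : set T) :
  (forall C, Delta C -> finite_set C) ->
  (forall C, Delta C -> ~ C `<=` A) ->
  exists F, [/\ A `<=` F, forall C, Delta C -> ~ C `<=` F &
    forall x, ~ F x -> exists2 C, Delta C & C `<=` x |` F].
Proof.
move=> finD avoidA.
(* The union with [A] is built into the property, instead of requiring [A] inside [F], because the
   empty chain has union [set0], which need not include [A]. *)
have [|F [avoidF maxF]] := @Zorn_bigcup T
    [set F | forall C, Delta C -> ~ C `<=` F `|` A].
  move=> F avoidF totF C DC.
  move=> /(finite_sub_bigcup_chain totF (finD _ DC))[|[X FX]].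
    exact: avoidA.
  exact: avoidF.
exists (F `|` A); split=> // x nFx.
have : ~ forall C, Delta C -> ~ C `<=` (x |` F) `|` A.
  apply: maxF; split; first by move=> y Fy; right.
  by move=> sub; apply: nFx; left; apply: sub; left.
move=> /existsNP[C /not_implyP[DC /contrapT CF]].
by exists C => //; rewrite setUA.
Qed.

(** * Derived resolution steps *)

Section Resolution.
Variables (G : Type) (Gamma : set (set (literal G))).

Lemma RES_finite C : (forall D, Gamma D -> finite_set D) ->
  RES Gamma C -> finite_set C.
Proof.
move=> finGamma; elim=> [D /finGamma //|a|A B a _ + _ +].
  exact: finite_set2.
by rewrite !finite_setU => -[? _] [].
Qed.

Lemma RES_resolve {C D a} :
  C (Pos a) -> D (Neg a) -> RES Gamma C -> RES Gamma D ->
  RES Gamma (C `\ Pos a `|` D `\ Neg a).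
Proof.
move=> Ca Da RC RD; apply: (RES_resolution (a := a)).
- by rewrite setUC setD1K.
- by rewrite setUC setD1K.
Qed.

Lemma RES_remove_pos C a : RES Gamma C -> RES Gamma [set Neg a] ->
  RES Gamma (C `\ Pos a).
Proof.
move=> RC Ra; have [Ca|nCa] := pselect (C (Pos a)).
  have := RES_resolve Ca erefl RC Ra; by rewrite setDv setU0.
rewrite (_ : C `\ Pos a = C) //.
by apply/seteqP; split=> [l []//|l Cl]; split=> // la; apply: nCa; rewrite -la.
Qed.

(** One resolution per atom of [X], hence the finiteness of [X]. It serves to delete refuted
    out-neighbours from a clause. *)
Lemma RES_remove_all_pos C X : RES Gamma C -> finite_set X ->
  (forall x, X x -> RES Gamma [set Neg x]) -> RES Gamma (C `\` (@Pos G @` X)).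
Proof.
move=> RC; elim/finite_set_induction: X / => [_|x X IH RX].
  by rewrite image_set0 setD0.
rewrite image_setU image_set1 setUC -setDDl; apply: RES_remove_pos.
- by apply: IH => y Xy; apply: RX; right.
- by apply: RX; left.
Qed.

End Resolution.

(** * Soundness of resolution for the triples [alpha_of E S] *)

Section Digraph.
Context {G : Type} {E : G -> G -> Prop}.
Implicit Types (S X : set G) (C : set (literal G)).
Local Notation Gamma := (clausal_theory E).
Local Notation "|- C" := (RES Gamma C) (at level 70, no associativity).

Lemma inns_closed_out S x y : inns_closed E S -> E x y ->
  valbot (alpha_of E S) x -> valbot (alpha_of E S) y.
Proof. by move=> cl Exy nx Dy; apply: nx; apply: cl; exists y. Qed.

(** Closure under predecessors is what handles an undefined [x]: all its out-neighbours are then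
    undefined too, so the whole clause is. *)
Lemma sat_out_clause S x : inns_closed E S ->
  sat (alpha_of E S) ([set Pos x] `|` (@Pos G @` out E x)).
Proof.
move=> cl; have [[Sx|[y Sy Exy]]|nDx] := pselect (inns_refl E S x).
- by apply: Or31; exists x; split=> //; left.
- by apply: Or31; exists y; split=> //; right; exists y.
- apply: Or33; split; last by exists x.
  by move=> z [] [] // => [[->]|[y Exy [<-]]|[]] //; exact: inns_closed_out Exy _.
Qed.

Lemma sat_edge_clause S x y : semikernel E S -> inns_closed E S -> E x y ->
  sat (alpha_of E S) [set Neg x; Neg y].
Proof.
move=> [SS _] cl Exy; have [Ix|nIx] := pselect (inns E S x).
  by apply: Or32; exists x; split=> //; left.
have [Iy|nIy] := pselect (inns E S y).
  by apply: Or32; exists y; split=> //; right.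
(* If [x] were in [S], its out-neighbour [y] would be in [inns E S] by the semikernel condition. *)
have nDx : ~ inns_refl E S x.
  by case=> // Sx; apply: nIy; apply: SS; exists x.
apply: Or33; split; last by exists x.
by move=> z [] [] // [->] //; exact: inns_closed_out Exy _.
Qed.

(** A true literal other than the pivot survives in the resolvent. If the pivot literal is true in
    one premise, its complement is neither true nor undefined, so the other premise has another true
    literal. Two wholly undefined premises give a wholly undefined resolvent. *)
Lemma sat_resolution (alpha : set_triple G) (A B : set (literal G)) a :
  is_3partition alpha ->
  sat alpha (A `|` [set Pos a]) -> sat alpha (B `|` [set Neg a]) ->
  sat alpha (A `|` B).
Proof.
case=> /seteqP[d10 _] /seteqP[d1b _] /seteqP[d0b _] _.
case=> [[x [[Ax|/= [->]] x1]]|[x [[Ax|//] x0]]|[Abot [b bb]]].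
- by move=> _; apply: Or31; exists x; split=> //; left.
- case=> [[y [[By|//] y1]]|[y [[By|/= [->]] y0]]|[Bbot _]].
  + by apply: Or31; exists y; split=> //; right.
  + by apply: Or32; exists y; split=> //; right.
  + by case: (d10 a).
  + by case: (d1b a); split=> //; apply: Bbot; right; right.
- by move=> _; apply: Or32; exists x; split=> //; left.
have abot : valbot alpha a by apply: Abot; left; right.
case=> [[y [[By|//] y1]]|[y [[By|/= [->]] y0]]|[Bbot _]].
- by apply: Or31; exists y; split=> //; right.
- by apply: Or32; exists y; split=> //; right.
- by case: (d0b a).
- apply: Or33; split; last by exists b.
  move=> z [] [z_in|z_in].
  + by apply: Abot; left; left.
  + by apply: Bbot; left; left.
  + by apply: Abot; right; left.
  + by apply: Bbot; right; left.
Qed.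

Lemma RES_sound S C : semikernel E S -> inns_closed E S -> |- C ->
  sat (alpha_of E S) C.
Proof.
move=> sk cl; elim=> [D [[x ->]|[x [y [Exy ->]]]]|a|A B a _ satA _ satB].
- exact: sat_out_clause.
- exact: sat_edge_clause.
- have [[Sa|Ia]|nDa] := pselect (inns_refl E S a).
  + by apply: Or31; exists a; split=> //; left.
  + by apply: Or32; exists a; split=> //; right.
  + by apply: Or33; split; [move=> z [] [] // [->]|exists a].
- exact: sat_resolution (alpha_of_3partition sk) satA satB.
Qed.

(** By soundness, a defined atom of [Gbot] would be both true and false. *)
Lemma inns_refl_sub_Gok S : semikernel E S -> inns_closed E S ->
  inns_refl E S `<=` Gok E.
Proof.
move=> sk cl x Dx [/(RES_sound sk cl) satP /(RES_sound sk cl) satN].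
have Sx : S x.
  by case: satP => [[y [[->]]]|[y []//]|[sub _]] //; case: (sub x _ Dx); left.
have [_ /(_ x)] := sk; apply=> //.
by case: satN => [[y []//]|[y [[->]]]|[sub _]] //; case: (sub x _ Dx); right.
Qed.

(** * Finite out-degree: derivations about [Gbot] and [Gok] *)

Hypothesis out_finite : forall x, finite_set (out E x).

Lemma clausal_theory_finite C : Gamma C -> finite_set C.
Proof.
case=> [[x ->]|[x [y [_ ->]]]]; last exact: finite_set2.
by rewrite finite_setU; split; [exact: finite_set1|exact: finite_image].
Qed.

Lemma RES_clausal_finite {C} : |- C -> finite_set C.
Proof. exact: RES_finite clausal_theory_finite. Qed.

Lemma RES_out_clause x : |- [set Pos x] `|` (@Pos G @` out E x).
Proof. by apply: RES_hyp; left; exists x. Qed.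

Lemma RES_edge_clause x y : E x y -> |- [set Neg x; Neg y].
Proof. by move=> Exy; apply: RES_hyp; right; exists x, y. Qed.

Lemma RES_neg_in x y : E x y -> |- [set Pos y] -> |- [set Neg x].
Proof.
move=> Exy Ry; have -> : [set Neg x] = set0 `|` [set Neg x] by rewrite set0U.
apply: (RES_resolution (a := y)); first by rewrite set0U.
exact: RES_edge_clause.
Qed.

Lemma RES_neg_out x y : E x y -> |- [set Pos x] -> |- [set Neg y].
Proof.
move=> Exy Rx; have -> : [set Neg y] = set0 `|` [set Neg y] by rewrite set0U.
apply: (RES_resolution (a := x)); first by rewrite set0U.
by rewrite setUC; exact: RES_edge_clause.
Qed.

(** The unit clause of [x] refutes every out-neighbour, [y] included. With [x] refuted as well, all
    atoms but [y] can be deleted from the out-clause of [x], which leaves the unit clause of [y]. *)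
Lemma Gbot_out x y : E x y -> Gbot E x -> Gbot E y.
Proof.
move=> Exy [Rx Rnx]; split; last exact: RES_neg_out Rx.
pose X := (x |` out E x) `\ y.
have -> : [set Pos y] =
    ([set Pos x] `|` (@Pos G @` out E x)) `\` (@Pos G @` X).
  apply/seteqP; split=> [_ ->|l].
    split; first by right; exists y.
    by move=> [z [_ zy] [zy']]; apply: zy.
  move=> [[->|[z Exz <-]] nX]; apply: contrapT => nl; apply: nX.
    by exists x => //; split; [left|move=> /= xy; apply: nl; rewrite xy].
  by exists z => //; split; [right|move=> /= zy; apply: nl; rewrite zy].
apply: RES_remove_all_pos; first exact: RES_out_clause.
- apply: finite_setD; rewrite finite_setU; split=> //; exact: finite_set1.
- by move=> z [[->//|Exz] _]; exact: RES_neg_out Rx.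
Qed.

Lemma Gok_in x y : E x y -> Gok E y -> Gok E x.
Proof. by move=> Exy oky /(Gbot_out Exy). Qed.

(** Out-neighbours in [Gbot] are refuted, so they can be resolved away. This gives a clause over
    [Gok] to which the avoidance condition applies. *)
Lemma RES_out_clause_Gok x :
  Gok E x -> |- [set Pos x] `|` (@Pos G @` (out E x `&` Gok E)).
Proof.
move=> okx.
have -> : [set Pos x] `|` (@Pos G @` (out E x `&` Gok E)) =
    ([set Pos x] `|` (@Pos G @` out E x)) `\` (@Pos G @` (out E x `\` Gok E)).
  apply/seteqP; split=> l.
    case=> [->|[y [Exy oky] <-]]; split; first by left.
    - by move=> [z [_ nz] [zx]]; apply: nz; rewrite zx.
    - by right; exists y.
    - by move=> [z [_ nz] [zy]]; apply: nz; rewrite zy.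
  move=> [[->|[y Exy <-]] nX]; first by left.
  right; exists y => //; split=> //; apply: contrapT => ny; apply: nX.
  by exists y.
apply: RES_remove_all_pos; first exact: RES_out_clause.
- exact: finite_setD.
- by move=> y [_ /contrapT []].
Qed.

(** * Semikernels defined exactly on [Gok], and the members of [Mod] *)

Lemma Gok_semikernel_avoiding (A : set (literal G)) :
  (forall B, |- B -> B !=set0 -> B `<=` literals (Gok E) -> ~ B `<=` A) ->
  exists S, [/\ semikernel E S, inns_refl E S = Gok E &
    ~ (pos_atoms A `&` S !=set0) /\ ~ (neg_atoms A `&` inns E S !=set0)].
Proof.
move=> avoidA.
pose Delta : set (set (literal G)) :=
  [set C | [/\ |- C, C !=set0 & C `<=` literals (Gok E)]].
have [||F [AF avoidF maxF]] := @maximal_avoiding _ Delta A.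
- by move=> C [/RES_clausal_finite].
- by move=> C [RC C0 Cok]; exact: avoidA.
(* [F] holds exactly one literal of each atom of [Gok]: having both would include an axiom, and
   lacking both yields two blocking clauses whose resolvent on [x] lies in [F]. *)
have Fneg x : Gok E x -> F (Neg x) <-> ~ F (Pos x).
  move=> okx; split=> [Fn Fp|nFp].
    apply: (avoidF [set Pos x; Neg x]); last by move=> l [] ->.
    split; [exact: RES_axiom|by exists (Pos x); left|].
    by move=> l [] ->; [left|right]; exists x.
  apply: contrapT => nFn.
  have [C [RC C0 Cok] CF] := maxF _ nFp.
  have [D [RD D0 Dok] DF] := maxF _ nFn.
  have Cx : C (Pos x).
    apply: contrapT => nCx; apply: (avoidF C) => // l Cl.
    by have [lx|//] := CF _ Cl; case: nCx; rewrite -lx.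
  have Dx : D (Neg x).
    apply: contrapT => nDx; apply: (avoidF D) => // l Dl.
    by have [lx|//] := DF _ Dl; case: nDx; rewrite -lx.
  apply: (avoidF (C `\ Pos x `|` D `\ Neg x)); last first.
    by move=> l [[/CF[->|//] []]|[/DF[->|//] []]].
  split; first exact: RES_resolve.
  - apply: contrapT => /nonemptyPn; rewrite setU_eq0 => -[CP DN].
    apply: okx; split.
    + by rewrite -(setD1K Cx) CP setU0 in RC.
    + by rewrite -(setD1K Dx) DN setU0 in RD.
  - by move=> l [[/Cok]|[/Dok]].
pose S : set G := [set x | Gok E x /\ ~ F (Pos x)].
have indep : inns E S `<=` ~` S.
  move=> x [y [oky nFy] Exy] [okx nFx].
  apply: (avoidF [set Neg x; Neg y]).
    split; [exact: RES_edge_clause|by exists (Neg x); left|].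
    by move=> l [] ->; right; [exists x|exists y].
  by move=> l [] ->; apply/Fneg.
have innsS_ok x : inns E S x -> Gok E x.
  by move=> [y [oky _] Exy]; exact: Gok_in Exy oky.
(* Otherwise all literals of the out-clause restricted to [Gok] would be in [F]. *)
have defined x : Gok E x -> ~ S x -> inns E S x.
  move=> okx nSx; apply: contrapT => nIx.
  apply: (avoidF _ _ (_ : [set Pos x] `|` (@Pos G @` (out E x `&` Gok E)) `<=` F)).
    split; [exact: RES_out_clause_Gok|by exists (Pos x); left|].
    by move=> l [->|[y [_ oky] <-]]; left; [exists x|exists y].
  move=> l [->|[y [Exy oky] <-]]; apply: contrapT => nF.
    by apply: nSx.
  by apply: nIx; exists y.
exists S; split.
- split=> // y [x Sx Exy].
  (* [Gok] need not be closed under out-neighbours. But if [y] were in [Gbot], its unit clause would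
     refute [x], and the derivable unit clause [[set Neg x]] would be included in [F]. *)
  have oky : Gok E y.
    move=> [Ry _]; have [okx nFx] := Sx.
    apply: (avoidF [set Neg x]).
      split; [exact: RES_neg_in Exy Ry|by exists (Neg x)|].
      by move=> l ->; right; exists x.
    by move=> l ->; apply/Fneg.
  by apply: defined => // Sy; apply: (indep x) => //; exists y.
- apply/seteqP; split=> [x [[]//|/innsS_ok//]|x okx].
  by have [Sx|nSx] := pselect (S x); [left|right; exact: defined].
- split=> [[x [/AF Fx [_]]]//|[x [/AF Fx Ix]]].
  have okx := innsS_ok _ Ix.
  by apply: (indep x) => //; split=> //; apply/Fneg.
Qed.

Lemma inns_closed_Gok S : inns_refl E S = Gok E -> inns_closed E S.
Proof.
by rewrite /inns_closed => -> x [y oky Exy]; exact: Gok_in Exy oky.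
Qed.

(** All competing semikernels are defined within [Gok], and one attains [Gok]; so maximality means
    being defined on all of it. *)
Lemma Mod_inns_refl S :
  Mod E S <-> semikernel E S /\ inns_refl E S = Gok E.
Proof.
split=> [[sk cl maxS]|[sk DS]]; last first.
  split=> //; first exact: inns_closed_Gok.
  by move=> [R [skR clR []]]; rewrite DS => _; apply; exact: inns_refl_sub_Gok.
(* With nothing to falsify, [set0] includes no nonempty clause, so existence is unconditional. *)
split=> //; have [R [skR DR _]] : exists R, [/\ semikernel E R,
    inns_refl E R = Gok E & ~ (pos_atoms set0 `&` R !=set0) /\
    ~ (neg_atoms set0 `&` inns E R !=set0)].
  by apply: Gok_semikernel_avoiding => B _ [l Bl] _ /(_ l Bl).
apply/seteqP; split; first exact: inns_refl_sub_Gok.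
apply: contrapT => nsub; apply: maxS; exists R; split=> //.
  exact: inns_closed_Gok.
by rewrite DR; split=> //; exact: inns_refl_sub_Gok.
Qed.

End Digraph.

Unset Implicit Arguments.

Theorem corollary4p11 (G : Type) (E : G -> G -> Prop)
  (out_finite : forall x : G, finite_set (out E x))
  (A : set (literal G)) (A_clause : is_clause A) :
  entails E A <->
  (A `<=` literals (Gbot E) /\ Gbot E !=set0)
  \/ (exists B : set (literal G),
        [/\ is_clause B, B !=set0, B `<=` A `&` literals (Gok E) &
            RES (clausal_theory E) B]).
Proof.
split=> [entA|+ S /(Mod_inns_refl out_finite)[sk DS]].
- apply: contrapT => /not_orP[nbot nder].
  (* Failure of the second alternative is the avoidance hypothesis for [A]. *)
  have [|S [sk DS [npos nneg]]] := @Gok_semikernel_avoiding G E out_finite A.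
    move=> B RB B0 Bok BA; apply: nder; exists B; split=> //.
      exact: RES_clausal_finite out_finite _ RB.
    by move=> l Bl; split; [exact: BA|exact: Bok].
  (* No literal of [A] is true under this [S], so [A] must be wholly undefined, that is, over
     [Gbot]. *)
  have /entA[//|//|] : Mod E S by apply/Mod_inns_refl.
  rewrite /= DS /Gok setCK => -[sub bot0]; apply: nbot; split=> //.
  by move=> [x|x] Ax; [left|right]; exists x => //; apply: sub; [left|right].
- case=> [[Abot [x botx]]|[B [_ [l Bl] BA RB]]].
    apply: Or33; rewrite /= DS /Gok setCK; split; last by exists x.
    by move=> y [] /Abot [] [z botz] // [<-].
  have := RES_sound sk (inns_closed_Gok out_finite DS) RB.
  case=> [[x [Bx Sx]]|[x [Bx Ix]]|[sub _]].
  + by apply: Or31; exists x; split=> //; case: (BA _ Bx).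
  + by apply: Or32; exists x; split=> //; case: (BA _ Bx).
  (* The literal [l] of the nonempty [B] is over [Gok], where every atom is defined, so [B] cannot
     be wholly undefined. *)
  + have [_ lok] := BA _ Bl.
    rewrite /= DS in sub.
    case: lok Bl => -[x okx <-] Bx; exfalso; apply: (sub x) => //; by [left|right].
Qed.
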